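(* Let $\gamma=\gamma_0+\kappa_+\chi_{D_+}-\kappa_-\chi_{D_-}\in L^\infty_+(\Omega)$ be a conductivity with indefinite inclusion $D=D_+\cup D_-$ with respect to $\gamma_0$, and let $\beta^{\mathrm L}$, $\beta$, $\Lambda_h$, $N^\delta$, $T_\pm$, $T_\pm^h$, $T_\pm^{h,\delta}$, $\mathcal M$, $\mathcal M_\pm$ be as in the context. Suppose that the regularization parameters $\alpha_\pm=\alpha_\pm(h,\delta)[\cdot]\colon\mathcal A\to\mathbb R$ are bounded by $$\alpha_\pm^{\mathrm L}(h,\delta)\le\alpha_\pm(h,\delta)[C]\le\alpha_\pm^{\mathrm U}(h,\delta)$$ for all $C\in\mathcal A$ and $h,\delta>0$, where the real-valued functions $\alpha_\pm^{\mathrm L}$ and $\alpha_\pm^{\mathrm U}$ satisfy $$\delta-\alpha_\pm^{\mathrm L}(h,\delta)\le\inf_{C\in\mathcal M}\inf\sigma(T_\pm^h(C))\quad\text{and}\quad\lim_{h,\delta\to0}\alpha_\pm^{\mathrm U}(h,\delta)=0.\qquad( * )$$ Then for any $\lambda>0$ there exists an $\epsilon_\lambda>0$ such that $$\mathcal M\subseteq\mathcal M_{\alpha_+(h,\delta),\alpha_-(h,\delta)}(T_+^{h,\delta},T_-^{h,\delta})\subseteq\mathcal M_{\lambda,\lambda}(T_+,T_-)$$ for all $h,\delta\in(0,\epsilon_\lambda]$. Moreover, if $\mathcal M$ is replaced by $\mathcal M_\pm$ in $( * )$ (i.e. $\delta-\alpha_\pm^{\mathrm L}(h,\delta)\le\inf_{C\in\mathcal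 M_\pm}\inf\sigma(T_\pm^h(C))$, with matching signs), then for any $\lambda>0$ there exists an $\epsilon_\lambda>0$ such that $$\mathcal M_\pm\subseteq\mathcal M_{\alpha_\pm(h,\delta)}(T_\pm^{h,\delta})\subseteq\mathcal M_\lambda(T_\pm)$$ for all $h,\delta\in(0,\epsilon_\lambda]$. Here every relation containing $\pm$ is understood to hold for both the $+$ version and the $-$ version.
   Context: Setting. $\Omega\subset\mathbb R^d$, $d\ge 2$, is an open bounded domain with $C^\infty$-regular boundary such that $\mathbb R^d\setminus\overline\Omega$ is connected. For real-valued $f$ on $\Omega$, $\inf(f)$ and $\sup(f)$ denote the essential infimum and supremum over $\Omega$. $L^\infty_+(\Omega)=\{w\in L^\infty(\Omega):\inf(w)>0\}$ (real-valued functions). $\chi_C$ is the characteristic function of $C$. Neumann-to-Dirichlet map. $\langle\cdot,\cdot\rangle$ is the $L^2(\partial\Omega)$-inner product, $L^2_\diamond(\partial\Omega)=\{w\in L^2(\partial\Omega):\langle w,1\rangle=0\}$, $H^1_\diamond(\Omega)=\{w\in H^1(\Omega):\langle w|_{\partial\Omega},1\rangle=0\}$, and $\mathcal L(L^2_\diamond(\partial\Omega))$ is the space of bounded linear operators on $L^2_\diamond(\partial\Omega)$. For $\gamma\in L^\infty_+(\Omega)$ and $f\in L^2_\diamond(\partial\Omega)$ let $u\in H^1_\diamond(\Omega)$ be the unique weak solution of $\nabla\cdot(\gamma\nabla u)=0$ in $\Omega$, $\nu\cdot\gamma\nabla u=f$ on $\partial\Omega$ ($\nu$ the outward unit normal).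 $\Lambda(\gamma)\colon L^2_\diamond(\partial\Omega)\to L^2_\diamond(\partial\Omega)$, $f\mapsto u|_{\partial\Omega}$, is a compact self-adjoint operator. For self-adjoint $A\in\mathcal L(L^2_\diamond(\partial\Omega))$, $A\ge 0$ means $\langle Af,f\rangle\ge0$ for all $f\in L^2_\diamond(\partial\Omega)$; $\sigma(A)$ is the spectrum; $\mathrm{Id}$ is the identity. Outer support and test inclusions. For $X\subseteq\overline\Omega$, $X^\bullet=\overline\Omega\setminus\bigcup\{U\subseteq\mathbb R^d\setminus X\text{ open and connected}: U\cap\partial\Omega\ne\emptyset\}$; $D_\pm^\bullet=(D_\pm)^\bullet$. $\mathcal A=\{C\subseteq\overline\Omega\text{ closed}:\mathbb R^d\setminus C\text{ connected}\}$. Indefinite inclusion. $\gamma=\gamma_0+\kappa_+\chi_{D_+}-\kappa_-\chi_{D_-}$ where $\gamma_0,\kappa_+,\kappa_-\in L^\infty_+(\Omega)$, $\sup(\kappa_-)<\inf(\gamma_0)$, and $D_+,D_-\subseteq\Omega$ are open and disjoint (either may be empty). $D=D_+\cup D_-$ is called an indefinite inclusion with respect to $\gamma_0$, provided also: any open neighbourhood of any $x\in\partial D^\bullet$ contains an open ball $B$ such that $B\cap\partial D^\bullet\neq\emptyset$, and either $B\cap D_+^\bullet=\emptyset$ or $B\cap D_-^\bullet=\emptyset$. The constant $\beta^{\mathrm L}>0$ satisfies $\beta^{\mathrm L}\le\gamma_0$ in $\Omega$, and $\beta>0$ satisfies $\sup(\kappa_+)\le\beta$ and $\sup(\kappa_-)\le\tfrac{\beta}{1+\beta}\beta^{\mathrm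 L}$. Approximate models and noise. For each $\delta>0$, $N^\delta\in\mathcal L(L^2_\diamond(\partial\Omega))$ is self-adjoint with $\|N^\delta\|\le\delta$. For each $h>0$ and each $\gamma\in L^\infty_+(\Omega)$, $\Lambda_h(\gamma)\in\mathcal L(L^2_\diamond(\partial\Omega))$ is compact and self-adjoint, and $\|\Lambda(\gamma)-\Lambda_h(\gamma)\|_{\mathcal L(L^2_\diamond(\partial\Omega))}\le\omega(h)\|\gamma\|_{L^\infty(\Omega)}$ for all $\gamma\in L^\infty_+(\Omega)$, with $\lim_{h\to0}\omega(h)=0$. The noisy measurement is $\Lambda_h^\delta(\gamma)=\Lambda_h(\gamma)+N^\delta$. Operators. For measurable $C\subseteq\overline\Omega$: $T_+(C)=\Lambda(\gamma)-\Lambda(\gamma_0+\beta\chi_C)$, $T_-(C)=\Lambda(\gamma_0-\tfrac{\beta}{1+\beta}\beta^{\mathrm L}\chi_C)-\Lambda(\gamma)$; $T_+^h(C)=\Lambda_h(\gamma)-\Lambda_h(\gamma_0+\beta\chi_C)$, $T_-^h(C)=\Lambda_h(\gamma_0-\tfrac{\beta}{1+\beta}\beta^{\mathrm L}\chi_C)-\Lambda_h(\gamma)$; $T_+^{h,\delta}(C)=\Lambda_h^\delta(\gamma)-\Lambda_h(\gamma_0+\beta\chi_C)$, $T_-^{h,\delta}(C)=\Lambda_h(\gamma_0-\tfrac{\beta}{1+\beta}\beta^{\mathrm L}\chi_C)-\Lambda_h^\delta(\gamma)$. Collections. For operator-valued maps $S_\pm$ with $S_\pm(C)\in\mathcal L(L^2_\diamond(\partial\Omega))$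 self-adjoint for each measurable $C\subseteq\overline\Omega$, and for $\alpha_\pm\colon\mathcal A\to\mathbb R$ (constants being allowed), $\mathcal M_{\alpha_+,\alpha_-}(S_+,S_-)=\{C\in\mathcal A: S_+(C)+\alpha_+(C)\mathrm{Id}\ge0\text{ and }S_-(C)+\alpha_-(C)\mathrm{Id}\ge0\}$, and $\mathcal M_\alpha(S)=\mathcal M_{\alpha,\alpha}(S,S)$. Further $\mathcal M_\pm=\mathcal M_0(T_\pm)=\{C\in\mathcal A:T_\pm(C)\ge0\}$ and $\mathcal M=\mathcal M_{0,0}(T_+,T_-)=\mathcal M_+\cap\mathcal M_-$. *)

(* Defs.v *)
From HB Require Import structures.
From mathcomp Require Import all_boot all_order all_algebra.
From mathcomp Require Import all_classical all_reals all_analysis.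
From mathcomp Require Import ess_sup_inf measurable_realfun.
Set Implicit Arguments.
Unset Strict Implicit.
Unset Printing Implicit Defensive.
Import Order.TTheory GRing.Theory Num.Theory.
Import numFieldNormedType.Exports.

Local Open Scope classical_set_scope.
Local Open Scope ring_scope.

(* T with the discrete sigma-algebra, so that the library's [mu_ext] ranges over
   coverings by arbitrary sets. *)
Definition discr (T : Type) : Type := T.

Section discr_instances.
Context (T : pointedType).
HB.instance Definition _ := Pointed.on (discr T).
HB.instance Definition _ := @isMeasurable.Build default_measure_display
  (discr T) (@discrete_measurable T) (@discrete_measurable0 T)
  (@discrete_measurableC T) (@discrete_measurableU T).
End discr_instances.

Section outer_measures.
Context (R : realType).
Local Open Scope ereal_scope.

Definition cover_outer (T : pointedType) (g : set T -> \bar R) (A : set T)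
    : \bar R :=
  @mu_ext _ (discr T) R g A.

Section cover_outer_theory.
Context (T : pointedType) (g : set T -> \bar R).
Hypotheses (g0 : g set0 = 0) (g_ge0 : forall A, 0 <= g A).

Lemma cover_outer0 : cover_outer g set0 = 0.
Proof. exact: (@mu_ext0 _ (discr T) R g g0 g_ge0). Qed.

Lemma cover_outer_ge0 A : 0 <= cover_outer g A.
Proof. exact: (@mu_ext_ge0 _ (discr T) R g g_ge0). Qed.

Lemma le_cover_outer : {homo cover_outer g : A B / A `<=` B >-> A <= B}.
Proof. exact: (@le_mu_ext _ (discr T) R g). Qed.

Lemma cover_outer_sigma_subadditive : sigma_subadditive (cover_outer g).
Proof. exact: (@mu_ext_sigma_subadditive _ (discr T) R g g_ge0). Qed.

End cover_outer_theory.

Definition enorm n (x : 'rV[R]_n) : R := Num.sqrt (\sum_(i < n) x 0 i ^+ 2).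

Definition eball n (x : 'rV[R]_n) (r : R) : set 'rV[R]_n :=
  [set y | (enorm (y - x) < r)%R].

Definition box n (a b : 'rV[R]_n) : set 'rV[R]_n :=
  [set x | forall i, (a 0 i <= x 0 i <= b 0 i)%R].

(* Least volume of a box containing A; +oo if A is unbounded. The case of the
   empty set only matters for n = 0. *)
Definition boxvol n (A : set 'rV[R]_n) : \bar R :=
  if `[< A = set0 >] then 0 else
  ereal_inf [set (\prod_(i < n) (ab.2 0 i - ab.1 0 i))%:E |
    ab in [set ab : 'rV[R]_n * 'rV[R]_n |
      (forall i, (ab.1 0 i <= ab.2 0 i)%R) /\ A `<=` box ab.1 ab.2]].

Definition lebesgue_outer n : set 'rV[R]_n -> \bar R :=
  cover_outer (@boxvol n).

Lemma boxvol0 n : @boxvol n set0 = 0.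
Proof. by rewrite /boxvol; case: asboolP. Qed.

Lemma boxvol_ge0 n A : 0 <= @boxvol n A.
Proof.
rewrite /boxvol; case: asboolP => // _; apply: le_ereal_inf_tmp.
move=> _ [ab [ab0 _] <-]; rewrite lee_fin; apply: prodr_ge0 => i _.
by rewrite subr_ge0.
Qed.

Definition diam n (A : set 'rV[R]_n) : \bar R :=
  ereal_sup [set (enorm (xy.1 - xy.2))%:E | xy in A `*` A].

Definition unit_ball_volume k : R :=
  fine (@lebesgue_outer k (eball 0 1)).

(* k-dimensional Hausdorff measure, normalised so that it agrees with
   k-dimensional surface area. *)
Definition hausdorff_gauge n (k : nat) (delta : R) (A : set 'rV[R]_n) : \bar R :=
  if `[< A = set0 >] then 0 else
  if diam A <= delta%:E
  then (unit_ball_volume k * (fine (diam A) / 2) ^+ k)%:E else +oo.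

Definition hausdorff_outer n (k : nat) (A : set 'rV[R]_n) : \bar R :=
  ereal_sup [set cover_outer (@hausdorff_gauge n k delta) A |
    delta in [set delta : R | (0 < delta)%R]].

Lemma hausdorff_gauge0 n k delta : @hausdorff_gauge n k delta set0 = 0.
Proof. by rewrite /hausdorff_gauge; case: asboolP. Qed.

Lemma hausdorff_gauge_ge0 n k delta A : 0 <= @hausdorff_gauge n k delta A.
Proof.
rewrite /hausdorff_gauge; case: asboolP => // /eqP/set0P[x Ax].
case: ifPn => // _; rewrite lee_fin mulr_ge0//.
  by apply/fine_ge0/cover_outer_ge0; exact: boxvol_ge0.
rewrite exprn_ge0// divr_ge0//; apply: fine_ge0.
apply: ereal_sup_ubound; exists (x, x) => //=.
rewrite subrr /enorm big1 ?sqrtr0// => i _; by rewrite mxE expr0n.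
Qed.

Section restriction.
Context n (D : set 'rV[R]_n).

(* Outer measures A |-> |A `&` Omega| and A |-> S(A `&` bd), restricted to
   their Caratheodory sigma-algebras below. *)
Definition volume_outer (A : set 'rV[R]_n) : \bar R :=
  lebesgue_outer (A `&` D).

Definition surface_outer (A : set 'rV[R]_n) : \bar R :=
  hausdorff_outer n.-1 (A `&` D).

Let volume0 : volume_outer set0 = 0.
Proof. by rewrite /volume_outer set0I; exact/cover_outer0/boxvol_ge0/boxvol0. Qed.

Let volume_ge0 A : 0 <= volume_outer A.
Proof. exact/cover_outer_ge0/boxvol_ge0. Qed.

Let le_volume : {homo volume_outer : A B / A `<=` B >-> A <= B}.
Proof. by move=> A B AB; apply: le_cover_outer; exact: setSI. Qed.

Let volume_sigma : sigma_subadditive volume_outer.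
Proof.
move=> F; rewrite /volume_outer setI_bigcupl.
by apply: cover_outer_sigma_subadditive; exact: boxvol_ge0.
Qed.

HB.instance Definition _ := isOuterMeasure.Build R 'rV[R]_n volume_outer
  volume0 volume_ge0 le_volume volume_sigma.

Let surface0 : surface_outer set0 = 0.
Proof.
rewrite /surface_outer set0I /hausdorff_outer.
rewrite (_ : image _ _ = [set 0]) ?ereal_sup1//.
apply/seteqP; split=> [_ [e /= e0 <-]|_ ->].
  by rewrite cover_outer0//; [exact: hausdorff_gauge0|exact: hausdorff_gauge_ge0].
exists 1%R => //=; rewrite cover_outer0//.
  exact: hausdorff_gauge0.
exact: hausdorff_gauge_ge0.
Qed.

Let surface_ge0 A : 0 <= surface_outer A.
Proof.
apply: (@le_trans _ _ (cover_outer (@hausdorff_gauge n n.-1 1) (A `&` D))).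
  by apply: cover_outer_ge0; exact: hausdorff_gauge_ge0.
by apply: ereal_sup_ubound; exists 1%R => //=.
Qed.

Let le_surface : {homo surface_outer : A B / A `<=` B >-> A <= B}.
Proof.
move=> A B AB; apply: ge_ereal_sup => _ [e e0 <-].
apply: (@le_trans _ _ (cover_outer (@hausdorff_gauge n n.-1 e) (B `&` D))).
  by apply: le_cover_outer; exact: setSI.
by apply: ereal_sup_ubound; exists e.
Qed.

Let surface_sigma : sigma_subadditive surface_outer.
Proof.
move=> F; apply: ge_ereal_sup => _ [e e0 <-]; rewrite setI_bigcupl.
apply: le_trans (cover_outer_sigma_subadditive _ _) _.
  exact: hausdorff_gauge_ge0.
apply: lee_nneseries => [i _ _|i _].
  by apply: cover_outer_ge0; exact: hausdorff_gauge_ge0.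
by apply: ereal_sup_ubound; exists e.
Qed.

HB.instance Definition _ := isOuterMeasure.Build R 'rV[R]_n surface_outer
  surface0 surface_ge0 le_surface surface_sigma.

End restriction.
End outer_measures.

Section L2_space.
Context d (T : measurableType d) (R : realType).
Variable mu : {measure set T -> \bar R}.

Definition Lfun2 : Type := LfunType mu (lee1n 2).
HB.instance Definition _ := GRing.Lmodule.on Lfun2.

Definition null_fun : {pred Lfun2} :=
  fun f => `[< {ae mu, forall x, (f : T -> R) x = 0} >].

Lemma null_fun_zmod_closed : zmod_closed null_fun.
Proof.
split; first by apply/asboolP; exact: aeW.
move=> f g /asboolP f0 /asboolP g0; apply/asboolP.
apply: filterS2 f0 g0 => x fx gx.
have -> : ((f - g : Lfun2) : T -> R) x = (f : T -> R) x - (g : T -> R) x by [].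
by rewrite fx gx subrr.
Qed.

HB.instance Definition _ := GRing.isZmodClosed.Build Lfun2 null_fun
  null_fun_zmod_closed.


Definition L2 : Type := Quotient.quot (null_fun : zmodClosed Lfun2).
HB.instance Definition _ := GRing.Zmodule.on L2.
HB.instance Definition _ := Quotient.on L2.

Definition fun_of_L2 (f : L2) : T -> R := (repr f : Lfun2).
Coercion fun_of_L2 : L2 >-> Funclass.

Local Notation pi := (\pi_L2%qT : Lfun2 -> L2).

Lemma L2_eqP (f g : Lfun2) :
  pi f = pi g <-> {ae mu, forall x, (f : T -> R) x = (g : T -> R) x}.
Proof.
split=> [/eqP|fg].
  rewrite -Quotient.idealrBE => /asboolP; apply: filterS => x h.
  by apply/eqP; rewrite -subr_eq0; apply/eqP; exact: h.
apply/eqP; rewrite -Quotient.idealrBE; apply/asboolP; apply: filterS fg => x fgx.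
by apply/eqP; rewrite subr_eq0; apply/eqP; exact: fgx.
Qed.

Definition scale_L2 (a : R) (f : L2) : L2 := pi (a *: repr f).

Lemma scale_pi a (f : Lfun2) : scale_L2 a (pi f) = pi (a *: f).
Proof.
apply/L2_eqP; have /L2_eqP : pi (repr (pi f)) = pi f by rewrite reprK.
by apply: filterS => x /= fx; congr (_ * _).
Qed.

Lemma pi_L2D (f g : Lfun2) : pi (f + g) = pi f + pi g.
Proof. exact: (@Quotient.pi_add Lfun2 null_fun). Qed.

Lemma scale_L2A a b f : scale_L2 a (scale_L2 b f) = scale_L2 (a * b) f.
Proof. by rewrite -[f]reprK [scale_L2 b _]scale_pi !scale_pi scalerA. Qed.

Lemma scale_L21 : left_id 1 scale_L2.
Proof. by move=> f; rewrite -[f]reprK scale_pi scale1r. Qed.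

Lemma scale_L2Dr : right_distributive scale_L2 +%R.
Proof.
move=> a f g; rewrite -[f]reprK -[g]reprK -pi_L2D !scale_pi scalerDr.
exact: pi_L2D.
Qed.

Lemma scale_L2Dl f : {morph scale_L2^~ f : a b / a + b}.
Proof.
by move=> a b /=; rewrite -[f]reprK !scale_pi scalerDl; exact: pi_L2D.
Qed.

HB.instance Definition _ := GRing.Zmodule_isLmodule.Build R L2
  scale_L2A scale_L21 scale_L2Dr scale_L2Dl.

Definition ip (f g : L2) : R := \int[mu]_x (f x * g x).

Definition L2norm (f : L2) : R := Num.sqrt (ip f f).

(* The integrability clause is automatic when mu is finite. *)
Definition mean_zero : {pred L2} := fun f =>
  `[< mu.-integrable setT (EFin \o f) /\ \int[mu]_x f x = 0 >].

Lemma L2_measurable (f : L2) : measurable_fun setT (f : T -> R).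
Proof. exact: measurable_funPT. Qed.

Lemma L2_ae_lin a (f g : L2) :
  {ae mu, forall x, (a *: f + g : L2) x = a * f x + g x}.
Proof.
have /L2_eqP : pi (repr (a *: f + g)) = pi (a *: repr f + repr g).
  by rewrite reprK pi_L2D -scale_pi !reprK.
exact: filterS.
Qed.

Lemma mean_zero_submod_closed : submod_closed mean_zero.
Proof.
have aeE (f : L2) (g : T -> R) : mu.-integrable setT (EFin \o g) ->
    {ae mu, forall x, f x = g x} ->
    mu.-integrable setT (EFin \o f) /\ \int[mu]_x f x = \int[mu]_x g x.
  move=> ig fg; have mg := measurable_int _ ig.
  have /measurable_EFinP mf := L2_measurable f.
  split; last first.
    rewrite /Rintegral; congr fine; apply: ae_eq_integral => //.
    by apply: filterS fg => x /= ->.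
  apply/integrableP; split=> //; move/integrableP : ig => [_].
  apply: le_lt_trans; rewrite le_eqVlt; apply/orP; left; apply/eqP.
  apply: ae_eq_integral => //; [exact: measurableT_comp..|].
  by apply: filterS fg => x /= ->.
split.
  apply/asboolP; have [] := aeE 0 (cst 0).
  - exact: integrable0.
  - have /L2_eqP : pi (repr (0 : L2)) = pi 0.
      by rewrite reprK; apply: (addrI (pi 0)); rewrite -pi_L2D !addr0.
    exact: filterS.
  - by move=> ? ->; split => //; rewrite /Rintegral integral0.
move=> a f g /asboolP[fi f0] /asboolP[gi g0]; apply/asboolP.
have afi : mu.-integrable setT (EFin \o (fun x => a * (f : L2) x)).
  exact: (integrableZl _ a fi).
have [] := aeE (a *: f + g) (fun x => a * (f : L2) x + (g : L2) x).
- exact: (integrableD _ afi gi).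
- exact: L2_ae_lin.
- move=> ? ->; split => //.
  by rewrite RintegralD// RintegralZl// f0 g0 mulr0 addr0.
Qed.

HB.instance Definition _ := GRing.isSubmodClosed.Build R L2 mean_zero
  mean_zero_submod_closed.

Record L2dia := MkL2dia { L2dia_val :> L2; _ : L2dia_val \in mean_zero }.
HB.instance Definition _ := [isSub of L2dia for L2dia_val].
HB.instance Definition _ := [Choice of L2dia by <:].
HB.instance Definition _ := [SubChoice_isSubLmodule of L2dia by <:].

End L2_space.

(* opnorm is the least bound rather than a supremum over the unit ball, and most
   notions are stated for maps not known to be linear: boundedness and linearity
   of the Neumann-to-Dirichlet map are theorems, not part of its definition. *)
Section operators.
Context d (T : measurableType d) (R : realType).
Variable mu : {measure set T -> \bar R}.
Local Notation H := (L2dia mu).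
Implicit Types A B : H -> H.

Definition opnorm A : \bar R :=
  ereal_inf [set M%:E |
    M in [set M : R | 0 <= M /\ forall f, L2norm (A f) <= M * L2norm f]].

Definition bounded_op A : Prop := (opnorm A < +oo)%E.

Definition self_adjoint A : Prop := forall f g : H, ip (A f) g = ip f (A g).

Definition compact_op A : Prop := forall u : nat -> H,
  (exists M : R, forall n, L2norm (u n) <= M) ->
  exists (s : nat -> nat) (g : H), {homo s : m n / (m < n)%N} /\
    L2norm (A (u (s n)) - g : H) @[n --> \oo] --> (0 : R).

Definition psd A : Prop := forall f, 0 <= ip (A f) f.

Definition add_op A B : H -> H := fun f => A f + B f.

Definition sub_op A B : H -> H := fun f => A f - B f.

Definition shift A (a : R) : H -> H := fun f => A f + a *: f.

Definition resolvent_set A : set R := [set l |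
  exists B : {linear H -> H}, [/\ bounded_op B,
    cancel (shift A (- l)) B & cancel B (shift A (- l))]].

Definition spectrum A : set R := ~` resolvent_set A.

Definition inf_spectrum A : \bar R := ereal_inf [set l%:E | l in spectrum A].

End operators.

Section domains.
Context (R : realType) (n : nat).
Local Notation V := 'rV[R]_n.
Implicit Types (Omega U C X : set V).

Definition bdry X : set V := closure X `\` X°.

Definition partial (i : 'I_n) (f : V -> R) : V -> R := 'D_(delta_mx 0 i) f.

Definition iter_partial (s : seq 'I_n) (f : V -> R) : V -> R :=
  foldr partial f s.

Definition smooth (f : V -> R) : Prop := forall s : seq 'I_n,
  continuous (iter_partial s f) /\
  forall x i, derivable (iter_partial s f) x (delta_mx 0 i).

(* Locally Omega is a strict sublevel set of a smooth function with
   nonvanishing gradient. *)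
Definition smooth_boundary Omega : Prop := forall x, bdry Omega x ->
  exists (U : set V) (rho : V -> R), [/\ open U, U x, smooth rho,
    exists i, partial i rho x != 0 &
    forall y, U y -> (Omega y <-> rho y < 0)].

Definition smooth_domain Omega : Prop :=
  [/\ open Omega, connected Omega, Omega !=set0, bounded_set Omega &
      smooth_boundary Omega].

Definition outer_support Omega X : set V :=
  closure Omega `\` \bigcup_(U in [set U | [/\ open U, connected U,
    U `<=` ~` X & U `&` bdry Omega !=set0]]) U.

Definition admissible Omega : set (set V) :=
  [set C | [/\ C `<=` closure Omega, closed C & connected (~` C)]].

Definition volume Omega :
    {measure set (caratheodory_type (volume_outer Omega)) -> \bar R} :=
  [the outer_measure R V of volume_outer Omega].

Definition surface Omega :
    {measure set (caratheodory_type (surface_outer (bdry Omega))) -> \bar R} :=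
  [the outer_measure R V of surface_outer (bdry Omega)].

Definition essinf Omega (f : V -> R) : \bar R :=
  ess_inf (volume Omega) (EFin \o f).

Definition esssup Omega (f : V -> R) : \bar R :=
  ess_sup (volume Omega) (EFin \o f).

Definition Linfty_norm Omega (f : V -> R) : \bar R :=
  'N[volume Omega]_+oo [EFin \o f].

Definition Linfty_plus Omega : set (V -> R) := [set f |
  [/\ measurable_fun setT (f : caratheodory_type (volume_outer Omega) -> R),
      (Linfty_norm Omega f < +oo)%E & (0 < essinf Omega f)%E]].

Definition test_function Omega (phi : V -> R) : Prop :=
  smooth phi /\ exists K, [/\ compact K, K `<=` Omega &
    forall x, ~ K x -> phi x = 0].

Definition H1_pair Omega : Type :=
  Lfun2 (volume Omega) * ('I_n -> Lfun2 (volume Omega)).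

(* Pairs of a function in H^1(Omega) and its weak gradient. *)
Definition H1 Omega : set (H1_pair Omega) :=
  [set u : H1_pair Omega | forall phi i, test_function Omega phi ->
    \int[volume Omega]_x (u.1 x * partial i phi x) =
    - \int[volume Omega]_x (u.2 i x * phi x)].

(* The trace H^1(Omega) -> L^2(bdry Omega) as the continuous extension of the
   restriction of smooth functions. *)
Definition is_trace Omega (u : H1_pair Omega) (w : L2 (surface Omega)) : Prop :=
  exists phi : nat -> V -> R, [/\ forall k, smooth (phi k),
    'N[volume Omega]_2%:E [EFin \o (phi k \- u.1)%R]%E @[k --> \oo] --> 0%E,
    forall i,
      'N[volume Omega]_2%:E [EFin \o (partial i (phi k) \- u.2 i)%R]%E
        @[k --> \oo] --> 0%E &
    'N[surface Omega]_2%:E [EFin \o (phi k \- w)%R]%E @[k --> \oo] --> 0%E].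

Definition Ldia Omega : Type := L2dia (surface Omega).

(* w is the boundary value of the weak solution with Neumann datum f. *)
Definition neumann_solution Omega (gamma : V -> R) (f w : Ldia Omega) : Prop :=
  exists u : H1_pair Omega, [/\ H1 u, is_trace u w &
    forall (v : H1_pair Omega) (z : L2 (surface Omega)), H1 v -> is_trace v z ->
      \int[volume Omega]_x (gamma x * \sum_(i < n) u.2 i x * v.2 i x) =
      ip f z].

Definition NtD Omega (gamma : V -> R) (f : Ldia Omega) : Ldia Omega :=
  xget 0 [set w | neumann_solution gamma f w].

Definition indefinite_inclusion Omega (gamma0 kappap kappam : V -> R)
    (Dp Dm : set V) : Prop :=
  let Dpo := outer_support Omega Dp in
  let Dmo := outer_support Omega Dm in
  let Do := outer_support Omega (Dp `|` Dm) in
  [/\ Linfty_plus Omega gamma0, Linfty_plus Omega kappap,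
      Linfty_plus Omega kappam &
      (esssup Omega kappam < essinf Omega gamma0)%E] /\
  [/\ open Dp, open Dm, Dp `<=` Omega, Dm `<=` Omega & Dp `&` Dm = set0] /\
  forall x U, bdry Do x -> open U -> U x ->
    exists y r, [/\ 0 < r, eball y r `<=` U, eball y r `&` bdry Do !=set0 &
      eball y r `&` Dpo = set0 \/ eball y r `&` Dmo = set0].

Definition perturbed (gamma0 kappap kappam : V -> R) (Dp Dm : set V) : V -> R :=
  fun x => gamma0 x + kappap x * \1_Dp x - kappam x * \1_Dm x.

Definition test_plus (gamma0 : V -> R) (beta : R) C : V -> R :=
  fun x => gamma0 x + beta * \1_C x.

Definition test_minus (gamma0 : V -> R) (beta betaL : R) C : V -> R :=
  fun x => gamma0 x - beta / (1 + beta) * betaL * \1_C x.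

(* T_+ and T_- for a model L of the Neumann-to-Dirichlet map and a measured
   operator A. *)
Definition Tplus Omega (L : (V -> R) -> Ldia Omega -> Ldia Omega)
    (A : Ldia Omega -> Ldia Omega) gamma0 beta C : Ldia Omega -> Ldia Omega :=
  sub_op A (L (test_plus gamma0 beta C)).

Definition Tminus Omega (L : (V -> R) -> Ldia Omega -> Ldia Omega)
    (A : Ldia Omega -> Ldia Omega) gamma0 beta betaL C :
    Ldia Omega -> Ldia Omega :=
  sub_op (L (test_minus gamma0 beta betaL C)) A.

Definition MM Omega (ap am : set V -> R)
    (Sp Sm : set V -> Ldia Omega -> Ldia Omega) : set (set V) :=
  [set C | [/\ admissible Omega C, psd (shift (Sp C) (ap C)) &
    psd (shift (Sm C) (am C))]].

Definition MM1 Omega (a : set V -> R) (S : set V -> Ldia Omega -> Ldia Omega) :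
    set (set V) := MM a a S S.

End domains.

(* Main.v *)
Require Import Defs.
From mathcomp Require Import all_boot all_order all_algebra.
From mathcomp Require Import all_classical all_reals all_analysis.
From mathcomp Require Import ess_sup_inf measurable_realfun ring lra.
Import Order.TTheory GRing.Theory Num.Theory.
Import numFieldNormedType.Exports.
Local Open Scope classical_set_scope.
Local Open Scope ring_scope.

(** The perturbations are small in the sense of quadratic forms, uniformly
    over the test sets.  The noise changes the form of the measured operator by
    at most delta times the squared norm.  Replacing Lambda by Lambda_h costs at
    most |omega(h)| times the sup norm of the conductivity, and that norm is
    bounded independently of the test set C, because the test conductivities
    are gamma_0 plus a fixed multiple of the indicator of C
    ([Linfty_plus_add_indic]).

    A spectral lower bound m for a discrete comparison operator T^h(C) is a
    lower bound m for its form ([inf_spectrum_le_form]); with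
    m = delta - alpha^L, adding noise of size delta leaves the form above
    - alpha^L >= - alpha(C).  This is the first inclusion.  For the second, the
    form of T(C) is above - (alpha^U + delta + 2 |omega(h)| L), where L bounds
    all the sup norms involved, and this exceeds - lambda as soon as h and delta
    are small, whatever C is.

    Two facts have to be supplied.  Reading the form bound off the spectrum is
    done without a spectral theorem: the best lower bound of the form of a
    self-adjoint operator belongs to the spectrum, since at a point l below
    the form, a bounded inverse of A - l makes A - l coercive
    ([resolvent_coercive]), so that l was not the best bound.  And the
    approximation estimate applies to the test conductivities only if they are
    measurable; this holds because closed sets are Caratheodory measurable for
    the volume ([closed_measurable]), which follows from the fact that cutting a
    box by a coordinate hyperplane splits its volume additively
    ([boxvol_cut]). *)

(** * Quadratic forms and the bottom of the spectrum *)

(** Stated for an arbitrary symmetric form because it is used twice: for the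
    inner product, and for the form of a nonnegative operator. *)
Lemma psd_form_cauchy_schwarz (R : realType) (V : lmodType R)
    (b : V -> V -> R) (b_sym : forall f g, b f g = b g f)
    (b_lin : forall f a g h, b f (a *: g + h) = a * b f g + b f h)
    (b_ge0 : forall f, 0 <= b f f) (f g : V) :
  b f g ^+ 2 <= b f f * b g g.
Proof.
have expand s : b (s *: g + f) (s *: g + f) =
    s ^+ 2 * b g g + 2 * s * b f g + b f f.
  rewrite b_lin (b_sym (s *: g + f) g) (b_sym (s *: g + f) f) !b_lin.
  by rewrite (b_sym g f); ring.
have [gg_gt0|] := ltP 0 (b g g).
  have := b_ge0 (- (b f g / b g g) *: g + f); rewrite expand.
  have -> : (- (b f g / b g g)) ^+ 2 * b g g + 2 * - (b f g / b g g) * b f g +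
      b f f = (b f f * b g g - b f g ^+ 2) / b g g by field; rewrite gt_eqF.
  by rewrite pmulr_lge0 ?invr_gt0// subr_ge0.
move=> gg_le0; have gg0 : b g g = 0 by apply/eqP; rewrite eq_le gg_le0 b_ge0.
(* On an isotropic direction g the form is affine along f + t g; at this t it
   would take the value -1. *)
have [->|fg_neq0] := eqVneq (b f g) 0; first by rewrite gg0 mulr0 expr0n.
have := b_ge0 (- ((b f f + 1) / (2 * b f g)) *: g + f); rewrite expand gg0.
have -> : (- ((b f f + 1) / (2 * b f g))) ^+ 2 * 0 +
   2 * - ((b f f + 1) / (2 * b f g)) * b f g + b f f = - 1 by field.
by rewrite oppr_ge0 ler10.
Qed.

Section inner_product.
Context {d} {T : measurableType d} {R : realType}.
Variable mu : {measure set T -> \bar R}.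
Local Notation H := (L2dia mu).

Lemma ip_sym (f g : L2 mu) : ip f g = ip g f.
Proof. by apply: eq_Rintegral => x _; rewrite mulrC. Qed.

Lemma L2_mul_integrable (f g : L2 mu) :
  mu.-integrable setT (EFin \o (fun x => f x * g x)).
Proof. by apply/Lfun1_integrable/Lfun2_mul_Lfun1; exact: LfunP. Qed.

Lemma ip_linear_r (f : L2 mu) a (g h : L2 mu) :
  ip f (a *: g + h) = a * ip f g + ip f h.
Proof.
have fg := L2_mul_integrable f g; have fh := L2_mul_integrable f h.
have afg : mu.-integrable setT (EFin \o (fun x => a * (f x * g x))).
  exact: (integrableZl _ a fg).
rewrite /ip -RintegralZl// -RintegralD//.
rewrite /Rintegral; congr fine; apply: ae_eq_integral => //.
- exact: measurable_int (L2_mul_integrable _ _).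
- apply/measurable_EFinP/measurable_funD; apply/measurable_EFinP.
    exact: measurable_int afg.
  exact: measurable_int fh.
- apply: filterS (L2_ae_lin a g h) => x /= -> _; congr EFin; ring.
Qed.

Lemma ip_ge0 (f : L2 mu) : 0 <= ip f f.
Proof. by apply: Rintegral_ge0 => x _; rewrite -expr2 sqr_ge0. Qed.

Lemma L2norm_sqr (f : L2 mu) : L2norm f ^+ 2 = ip f f.
Proof. by rewrite sqr_sqrtr// ip_ge0. Qed.

Lemma ip_cauchy_schwarz (f g : L2 mu) : `|ip f g| <= L2norm f * L2norm g.
Proof.
rewrite -(@ler_pXn2r _ 2) ?nnegrE ?mulr_ge0 ?sqrtr_ge0//.
rewrite -normrX ger0_norm ?sqr_ge0// exprMn !L2norm_sqr.
exact: (psd_form_cauchy_schwarz _ _ (@ip _ _ _ mu) ip_sym ip_linear_r ip_ge0).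
Qed.

Lemma ip_comb (f g h : H) a : ip (f + a *: g : H) h = ip f h + a * ip g h.
Proof.
rewrite ip_sym.
have -> : L2dia_val (f + a *: g) = a *: L2dia_val g + L2dia_val f.
  by rewrite addrC.
by rewrite ip_linear_r addrC !(ip_sym h).
Qed.

Lemma ip_add (f g h : H) : ip (f + g : H) h = ip f h + ip g h.
Proof. by rewrite -[g]scale1r ip_comb mul1r scale1r. Qed.

Lemma ip_sub (f g h : H) : ip (f - g : H) h = ip f h - ip g h.
Proof. by rewrite -scaleN1r ip_comb mulN1r. Qed.

Implicit Types A B : H -> H.

Lemma form_shift A a (f : H) :
  ip (Defs.shift A a f) f = ip (A f) f + a * ip f f.
Proof. exact: ip_comb. Qed.

Lemma psd_shiftP A (a : R) :
  psd (Defs.shift A a) <-> forall f : H, - a * ip f f <= ip (A f) f.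
Proof.
by split=> psdA f; move: (psdA f); rewrite form_shift; lra.
Qed.

(** [opnorm] is an infimum of admissible bounds, which is not assumed to be
    attained: hence the room [e']. *)
Lemma form_le_opnorm A M : (opnorm A <= M%:E)%E ->
  forall f : H, `|ip (A f) f| <= M * ip f f.
Proof.
move=> AM f; apply/ler_addgt0Pr => e e_gt0.
pose e' := e / (ip f f + 1).
have ff1_gt0 : 0 < ip f f + 1 by rewrite ltr_wpDl ?ip_ge0.
have e'_gt0 : 0 < e' by rewrite divr_gt0.
have : (opnorm A < (M + e')%:E)%E by rewrite (le_lt_trans AM)// lte_fin ltrDl.
move=> /ereal_inf_lt[_ [m [m_ge0 Am] <-]]; rewrite lte_fin => mM.
apply: (le_trans (ip_cauchy_schwarz _ _)).
apply: (@le_trans _ _ (m * ip f f)).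
  by rewrite -L2norm_sqr expr2 mulrA ler_wpM2r ?sqrtr_ge0.
apply: (@le_trans _ _ ((M + e') * ip f f)).
  by rewrite ler_wpM2r ?ip_ge0// ltW.
by rewrite mulrDl lerD2l /e' mulrAC ler_pdivrMr// ler_pM2l// lerDl ler01.
Qed.

Lemma bounded_form A : bounded_op A ->
  exists M, forall f : H, `|ip (A f) f| <= M * ip f f.
Proof.
move=> /ereal_inf_lt[_ [M [M_ge0 AM] <-]] _; exists M; apply: form_le_opnorm.
by apply: ereal_inf_lbound; exists M.
Qed.

Lemma form_bounded_sub A B :
  (exists M, forall f : H, `|ip (A f) f| <= M * ip f f) ->
  (exists M, forall f : H, `|ip (B f) f| <= M * ip f f) ->
  exists M, forall f : H, `|ip (sub_op A B f) f| <= M * ip f f.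
Proof.
move=> [M AM] [N BN]; exists (M + N) => f.
by rewrite ip_sub mulrDl (le_trans (ler_normB _ _))// lerD.
Qed.

Lemma self_adjoint_sub A B :
  self_adjoint A -> self_adjoint B -> self_adjoint (sub_op A B).
Proof.
move=> As Bs f g; rewrite ip_sub As Bs [RHS]ip_sym ip_sub.
by rewrite (ip_sym (A g)) (ip_sym (B g)).
Qed.

(** With S = A - l nonnegative, the Cauchy-Schwarz inequality for the form of S,
    applied to f and S f, gives |S f|^2 <= N <S f, f>; a bounded inverse of S
    then bounds |f|^2 by a multiple of <S f, f>. *)
Lemma resolvent_coercive A l (M : R) : self_adjoint A ->
  (forall f : H, `|ip (A f) f| <= M * ip f f) ->
  (forall f : H, l * ip f f <= ip (A f) f) -> resolvent_set A l ->
  exists2 c, 0 < c & forall f : H, (l + c) * ip f f <= ip (A f) f.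
Proof.
move=> As AM Al [B [+ SK _]]; set S := Defs.shift A (- l) => Bb.
have [_ [K [K_ge0 BK] <-] _] := ereal_inf_lt Bb.
pose b (f g : H) := ip (S f) g.
have bE f : b f f = ip (A f) f - l * ip f f by rewrite /b form_shift mulNr.
have b_ge0 f : 0 <= b f f by rewrite bE subr_ge0.
have b_sym f g : b f g = b g f.
  by rewrite /b !ip_comb As ip_sym (ip_sym f).
have b_lin f a g h : b f (a *: g + h) = a * b f g + b f h.
  exact: ip_linear_r.
pose N := `|M| + `|l|.
have bN f : b f f <= N * ip f f.
  rewrite bE /N mulrDl lerD//.
    apply: (le_trans (ler_norm _)); apply: (le_trans (AM f)).
    by rewrite ler_wpM2r ?ip_ge0// ler_norm.
  by rewrite -mulNr ler_wpM2r ?ip_ge0// -normrN ler_norm.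
have N_ge0 : 0 <= N by rewrite addr_ge0.
have SN f : ip (S f) (S f) <= N * b f f.
  have := psd_form_cauchy_schwarz _ _ b b_sym b_lin b_ge0 f (S f).
  rewrite {1}/b => /le_trans /(_ (ler_wpM2l (b_ge0 f) (bN (S f)))).
  have := ip_ge0 (S f); rewrite le_eqVlt => /predU1P[<- _|SS_gt0].
    by rewrite mulr_ge0.
  by rewrite expr2 mulrA ler_pM2r// mulrC.
have coercive (f : H) : ip f f <= (K ^+ 2 * N) * b f f.
  rewrite -mulrA -{1 2}(SK f).
  apply: (@le_trans _ _ (K ^+ 2 * ip (S f) (S f))); last first.
    by rewrite ler_wpM2l ?sqr_ge0.
  rewrite -!L2norm_sqr -exprMn ler_pXn2r ?nnegrE ?mulr_ge0 ?sqrtr_ge0//.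
pose k := K ^+ 2 * N + 1.
have k_gt0 : 0 < k by rewrite ltr_wpDl// mulr_ge0 ?sqr_ge0.
exists k^-1; first by rewrite invr_gt0.
move=> f; rewrite mulrDl -lerBrDl -bE mulrC ler_pdivrMr//.
apply: (le_trans (coercive f)); rewrite mulrC ler_wpM2l//.
by rewrite lerDl.
Qed.

(** The supremum of the lower bounds of the form is itself a lower bound, and by
    [resolvent_coercive] it cannot lie in the resolvent set. *)
Lemma inf_spectrum_le_form A m : self_adjoint A ->
  (exists M, forall f : H, `|ip (A f) f| <= M * ip f f) ->
  (m%:E <= inf_spectrum A)%E -> forall f : H, m * ip f f <= ip (A f) f.
Proof.
move=> As [M AM] mA.
pose Q := [set l : R | forall f : H, l * ip f f <= ip (A f) f].
have [//|notQm] := pselect (Q m).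
have Q_lt l : Q l -> l < m.
  move=> Ql; rewrite ltNge; apply/negP => ml; apply: notQm => f.
  by apply: le_trans (Ql f); rewrite ler_wpM2r ?ip_ge0.
have Q0 : Q !=set0.
  exists (- M) => f; have := AM f; rewrite ler_norml => /andP[+ _].
  by rewrite mulNr.
have supQ : has_sup Q.
  by split=> //; exists m => l /Q_lt/ltW.
have Qs : Q (sup Q).
  move=> f; have [ff0|ff_neq0] := eqVneq (ip f f) 0.
    by have [l Ql] := Q0; have := Ql f; rewrite ff0 !mulr0.
  have ff_gt0 : 0 < ip f f by rewrite lt_neqAle eq_sym ff_neq0 ip_ge0.
  rewrite -ler_pdivlMr//; apply: ge_sup => // l Ql.
  by rewrite ler_pdivlMr.
have : spectrum A (sup Q).
  move=> /(resolvent_coercive _ _ _ As AM Qs)[c c_gt0 Qc].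
  have := ub_le_sup supQ.2 Qc; rewrite gerDl leNgt c_gt0//.
move=> sQ; have : (m%:E <= (sup Q)%:E)%E.
  by apply: (le_trans mA); apply: ereal_inf_lbound; exists (sup Q).
by rewrite lee_fin leNgt Q_lt.
Qed.

End inner_product.

(** * Closed sets are measurable for the volume *)

Section closed_sets_are_measurable.
Context {R : realType} {n : nat}.
Local Notation V := 'rV[R]_n.
Local Open Scope ereal_scope.

Lemma boxvol_le_box (A : set V) (a b : V) :
  (forall i, (a 0 i <= b 0 i)%R) -> A `<=` box a b ->
  boxvol A <= (\prod_(i < n) (b 0 i - a 0 i))%:E.
Proof.
move=> ab Aab; rewrite /boxvol; case: asboolP => _.
  by rewrite lee_fin prodr_ge0// => i _; rewrite subr_ge0.
by apply: ereal_inf_lbound; exists (a, b).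
Qed.

(** The two hypotheses on [H] cover the open and the closed half-space at once.
    A box around [A] is cut at [c]. *)
Lemma boxvol_cut (i : 'I_n) (c : R) (H A : set V) :
  (forall x, H x -> (x 0 i <= c)%R) -> (forall x, ~ H x -> (c <= x 0 i)%R) ->
  boxvol (A `&` H) + boxvol (A `&` ~` H) <= boxvol A.
Proof.
move=> Hle Hge; have [->|A0] := pselect (A = set0).
  by rewrite !set0I boxvol0 adde0.
rewrite {3}/boxvol; case: asboolP => // _.
apply: le_ereal_inf_tmp => _ [[a b] /= [ab Aab] <-].
(* Clamping c to the side [a_i, b_i] yields two boxes even when the hyperplane
   misses the box; one of them is then flat. *)
pose c' := Num.max (a 0%R i) (Num.min (b 0%R i) c).
pose put (v : V) : V := (\row_j (if j == i then c' else v 0 j))%R.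
have ac' : (a 0 i <= c')%R by rewrite le_max lexx.
have c'b : (c' <= b 0 i)%R by rewrite ge_max ab ge_min lexx.
have putE (v : V) : put v 0%R i = c' by rewrite mxE eqxx.
have putN (v : V) j : j != i -> put v 0%R j = v 0%R j.
  by move=> ji; rewrite mxE (negbTE ji).
apply: (@le_trans _ _ ((\prod_(j < n) (put b 0 j - a 0 j))%:E +
                       (\prod_(j < n) (b 0 j - put a 0 j))%:E)).
  apply: leeD; apply: boxvol_le_box.
  - by move=> j; have [->|ji] := eqVneq j i; rewrite ?putE ?putN.
  - move=> x [/Aab Ax Hx] j; have /andP[ax xb] := Ax j; rewrite ax andTb.
    have [ji|ji] := eqVneq j i; last by rewrite putN.
    by subst j; rewrite putE !le_max le_min xb Hle// orbT.
  - by move=> j; have [->|ji] := eqVneq j i; rewrite ?putE ?putN.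
  - move=> x [/Aab Ax Hx] j; have /andP[ax xb] := Ax j; rewrite xb andbT.
    have [ji|ji] := eqVneq j i; last by rewrite putN.
    by subst j; rewrite putE ge_max ax ge_min Hge// orbT.
pose P := (\prod_(j < n | j != i) (b 0 j - a 0 j))%R.
have bE : (\prod_(j < n) (put b 0 j - a 0 j) = (c' - a 0 i) * P)%R.
  rewrite (bigD1 i)//= putE; congr (_ * _)%R.
  by apply: eq_bigr => j ji; rewrite putN.
have aE : (\prod_(j < n) (b 0 j - put a 0 j) = (b 0 i - c') * P)%R.
  rewrite (bigD1 i)//= putE; congr (_ * _)%R.
  by apply: eq_bigr => j ji; rewrite putN.
have abE : (\prod_(j < n) (b 0 j - a 0 j) = (b 0 i - a 0 i) * P)%R.
  by rewrite (bigD1 i).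
rewrite -EFinD lee_fin bE aE abE -mulrDl.
by rewrite [X in (X * P <= _)%R]addrC addrA subrK.
Qed.

(** A cover of [A] cuts into covers of its two parts, so the cutting inequality
    passes from a gauge to the outer measure that it generates. *)
Lemma cover_outer_cut (T : pointedType) (g : set T -> \bar R) (H A : set T) :
  (forall B, 0 <= g B) ->
  (forall B, g (B `&` H) + g (B `&` ~` H) <= g B) ->
  cover_outer g (A `&` H) + cover_outer g (A `&` ~` H) <= cover_outer g A.
Proof.
move=> g_ge0 g_cut; apply: le_ereal_inf_tmp => _ [F [_ AF] <-].
have le_cover (K : set T) :
    cover_outer g (A `&` K) <= \sum_(k <oo) g (F k `&` K).
  apply: ereal_inf_lbound; exists (fun k => F k `&` K) => //; split=> //.
  by rewrite -setI_bigcupl; exact: setSI.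
apply: (le_trans (leeD (le_cover H) (le_cover (~` H)))).
by rewrite -nneseriesD//; apply: lee_nneseries => // k _; rewrite adde_ge0.
Qed.

Variable Omega : set V.
Local Notation mT := (caratheodory_type (volume_outer Omega)).

Lemma half_space_measurable (i : 'I_n) (c : R) (H : set V) :
  (forall x, H x -> (x 0 i <= c)%R) -> (forall x, ~ H x -> (c <= x 0 i)%R) ->
  measurable (H : set mT).
Proof.
move=> Hle Hge.
apply: (@le_caratheodory_measurable _ _
  [the outer_measure R V of volume_outer Omega]) => X /=.
rewrite /volume_outer (setIAC X H) (setIAC X (~` H)); apply: cover_outer_cut.
  exact: boxvol_ge0.
by move=> B; exact: (boxvol_cut i c).
Qed.

Lemma box_measurable (a b : V) : measurable (box a b : set mT).
Proof.
have -> : box a b = \bigcap_(i in [set: 'I_n])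
    ([set x : V | (x 0 i <= b 0 i)%R] `&` ~` [set x : V | (x 0 i < a 0 i)%R]).
  apply/seteqP; split=> x.
    move=> abx i _; have /andP[ax xb] := abx i.
    by split=> //=; apply/negP; rewrite -leNgt.
  by move=> abx i; have [//= -> /negP] := abx i I; rewrite -leNgt => ->.
apply: fin_bigcap_measurable; first exact: finite_finset.
move=> i _; apply: measurableI; last apply: measurableC.
  apply: (half_space_measurable i (b 0%R i)) => // x /= /negP.
  by rewrite -ltNge => /ltW.
apply: (half_space_measurable i (a 0%R i)) => x /=; first exact: ltW.
by move=> /negP; rewrite -leNgt.
Qed.

(** Rational boxes make the union countable. *)
Lemma open_bigcup_rat_box (U : set V) : open U ->
  U = \bigcup_(ab : 'rV[rat]_n * 'rV[rat]_n)
    (if `[< box (map_mx ratr ab.1) (map_mx ratr ab.2) `<=` U >]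
     then box (map_mx ratr ab.1) (map_mx ratr ab.2) else set0).
Proof.
move=> oU; apply/seteqP; split; last first.
  by move=> x [ab _]; case: asboolP => // + abx; exact.
move=> x Ux; move: oU; rewrite openE => /(_ _ Ux)/nbhs_ballP[e /= e_gt0 eU].
have lo i : {q : rat | ratr q \in `](x 0 i - e)%R, x 0%R i[}.
  by apply: cid; apply: rat_in_itvoo; rewrite gtrBl.
have hi i : {q : rat | ratr q \in `]x 0%R i, (x 0 i + e)%R[}.
  by apply: cid; apply: rat_in_itvoo; rewrite ltrDl.
pose a := (\row_i sval (lo i))%R; pose b := (\row_i sval (hi i))%R.
exists (a, b) => //=.
have aP i : (x 0 i - e < ratr (a 0 i) < x 0 i)%R.
  by have := svalP (lo i); rewrite in_itv mxE.
have bP i : (x 0 i < ratr (b 0 i) < x 0 i + e)%R.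
  by have := svalP (hi i); rewrite in_itv mxE.
have ratE (q : 'rV[rat]_n) i : (map_mx ratr q : V) 0%R i = ratr (q 0%R i).
  by rewrite mxE.
case: asboolP => [_ i|].
  rewrite !ratE; have /andP[_ /ltW ->] := aP i.
  by have /andP[/ltW -> _] := bP i.
case; move=> y aby; apply: eU; split=> // j i.
rewrite (ord1 j) /ball/= distrC ltr_distl; have := aby i; rewrite !ratE.
have := aP i; have := bP i; lra.
Qed.

Lemma closed_measurable (C : set V) : closed C -> measurable (C : set mT).
Proof.
move=> /closed_openC/open_bigcup_rat_box CE; rewrite -(setCK C).
apply: measurableC; rewrite CE.
apply: (@countable_bigcupT_measurable _ mT); first exact: countableP.
by move=> ab; case: asboolP => _; [exact: box_measurable|exact: measurable0].
Qed.

End closed_sets_are_measurable.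

(** * Test conductivities *)

Section Linfty_norm.
Context {d} {T : measurableType d} {R : realType}.
Variable mu : {measure set T -> \bar R}.

Lemma Lnorm_pinfty_le (g : T -> R) (K : R) : 0 <= K ->
  {ae mu, forall x, `|g x| <= K} -> ('N[mu]_+oo [EFin \o g] <= K%:E)%E.
Proof.
move=> K_ge0 gK; rewrite unlock; case: ifPn => // _.
by apply/ess_supP; apply: filterS gK => x /= gxK; rewrite lee_fin.
Qed.

Lemma Lnorm_pinfty_ae_bound (g : T -> R) : measurable_fun setT g ->
  ('N[mu]_+oo [EFin \o g] < +oo)%E ->
  exists2 K, 0 <= K & {ae mu, forall x, `|g x| <= K}.
Proof.
move=> mg; rewrite unlock; case: ifPn => [_ g_lty|]; last first.
  rewrite -leNgt => mu_le0 _; exists 0 => //; exists setT; split=> //.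
  by apply/eqP; rewrite eq_le mu_le0 measure_ge0.
have := ess_sup_ge mu (abse \o (EFin \o g)).
move: g_lty; case: (ess_sup _ _) => [K _ gK|//|_ gK].
- exists `|K| => //; apply: filterS gK => x /=; rewrite lee_fin => /le_trans.
  by apply; exact: ler_norm.
- by exists 0 => //; apply: filterS gK => x /=.
Qed.

(** Almost everywhere [f] is above the smaller of [m] and [m + c]. *)
Lemma essinf_gt0_Linfty_add_indic (g : T -> R) (m c K : R) (C : set T) :
  measurable_fun setT g -> measurable C -> 0 < m -> 0 < m + c ->
  (m%:E <= ess_inf mu (EFin \o g))%E ->
  0 <= K -> {ae mu, forall x, `|g x| <= K} ->
  let f := (fun x => g x + c * \1_C x) in
  [/\ measurable_fun setT f, ('N[mu]_+oo [EFin \o f] <= (K + `|c|)%:E)%E &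
      (0 < ess_inf mu (EFin \o f))%E].
Proof.
move=> mg mC m_gt0 mc_gt0 mg_le K_ge0 gK f; split.
- by apply: measurable_funD => //; apply: measurable_funM => //.
- apply: Lnorm_pinfty_le; first by rewrite addr_ge0.
  apply: filterS gK => x gxK; apply: (le_trans (ler_normD _ _)).
  apply: lerD => //; rewrite normrM indicE.
  by case: (x \in C); rewrite ?normr1 ?normr0 ?mulr1 ?mulr0.
- apply: (@lt_le_trans _ _ (Num.min m (m + c))%:E).
    by rewrite lte_fin lt_min m_gt0.
  move/ess_infP in mg_le; apply/ess_infP; apply: filterS mg_le => x /=.
  rewrite !lee_fin ge_min /f indicE => mgx; case: (x \in C).
    by rewrite mulr1 lerD2r mgx orbT.
  by rewrite mulr0 addr0 mgx.
Qed.

End Linfty_norm.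

(** The constant [K] is chosen before [C]: this is what makes the approximation
    error uniform over the test sets. *)
Lemma Linfty_plus_add_indic (R : realType) (n : nat) (Omega : set 'rV[R]_n)
    (g : 'rV[R]_n -> R) (m : R) :
  Linfty_plus Omega g -> 0 < m -> (m%:E <= essinf Omega g)%E ->
  exists K : R, forall (c : R) C, closed C -> 0 < m + c ->
    Linfty_plus Omega (fun x => g x + c * \1_C x) /\
    (Linfty_norm Omega (fun x => g x + c * \1_C x)%R <= (K + `|c|)%:E)%E.
Proof.
move=> [mg g_lty _] m_gt0 mg_le.
have [K K_ge0 gK] := Lnorm_pinfty_ae_bound _ _ mg g_lty.
exists K => c C cC mc_gt0.
have [mf f_le f_gt0] := essinf_gt0_Linfty_add_indic _ _ _ _ _ _
  mg (closed_measurable Omega C cC) m_gt0 mc_gt0 mg_le K_ge0 gK.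
by split=> //; split=> //; apply: (le_lt_trans f_le); exact: ltry.
Qed.

(** * Perturbation of lower bounds *)

Section quadratic_form_distance.
Context {d} {T : measurableType d} {R : realType}.
Context {mu : {measure set T -> \bar R}}.
Local Notation H := (L2dia mu).
Implicit Types A B : H -> H.

(** Distance of operators measured on the diagonal of their forms, which is all
    that nonnegativity sees; it makes sense for plain maps, so that linearity
    of the Neumann-to-Dirichlet map never enters. *)
Definition form_close A B (e : R) : Prop :=
  forall f : H, `|ip (A f) f - ip (B f) f| <= e * ip f f.

Lemma form_close_refl A : form_close A A 0.
Proof. by move=> f; rewrite subrr normr0 mul0r. Qed.

Lemma form_close_sym A B e : form_close A B e -> form_close B A e.
Proof. by move=> AB f; rewrite distrC. Qed.

Lemma form_close_trans {A B C e e'} :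
  form_close A B e -> form_close B C e' -> form_close A C (e + e').
Proof.
move=> AB BC f; rewrite mulrDl.
exact: le_trans (ler_distD (ip (B f) f) _ _) (lerD (AB f) (BC f)).
Qed.

Lemma form_close_sub {A A' B B' e e'} :
  form_close A A' e -> form_close B B' e' ->
  form_close (sub_op A B) (sub_op A' B') (e + e').
Proof.
move=> AA' BB' f; rewrite !ip_sub mulrDl opprB.
rewrite [X in `|X|](_ : _ = (ip (A f) f - ip (A' f) f) -
  (ip (B f) f - ip (B' f) f)); last by ring.
exact: le_trans (ler_normB _ _) (lerD (AA' f) (BB' f)).
Qed.

Lemma form_close_add_op A B e : (opnorm B <= e%:E)%E ->
  form_close (add_op A B) A e.
Proof.
by move=> /form_le_opnorm Be f; rewrite ip_add addrAC subrr add0r.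
Qed.

Lemma form_close_opnorm A B e : (opnorm (sub_op A B) <= e%:E)%E ->
  form_close A B e.
Proof. move=> /form_le_opnorm ABe f; rewrite -ip_sub; exact: ABe. Qed.

Lemma psd_shift_close A B a b e : form_close A B e -> a + e <= b ->
  psd (Defs.shift A a) -> psd (Defs.shift B b).
Proof.
move=> AB aeb /psd_shiftP Aa; apply/psd_shiftP => f.
have /ler_normlP[_ ABf] := AB f.
have : (a + e) * ip f f <= b * ip f f by rewrite ler_wpM2r ?ip_ge0.
have := Aa f; nra.
Qed.

(** The spectral condition, transported from the discrete difference [A - B] to
    a noisy one at distance [e]. *)
Lemma psd_shift_inf_spectrum A A' B B' (m e a : R) :
  self_adjoint A -> bounded_op A -> self_adjoint B -> bounded_op B ->
  form_close (sub_op A B) (sub_op A' B') e -> e - a <= m ->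
  (m%:E <= inf_spectrum (sub_op A B))%E ->
  psd (Defs.shift (sub_op A' B') a).
Proof.
move=> As Ab Bs Bb close ea mAB; apply: (psd_shift_close _ _ (- m) _ _ close).
  by rewrite addrC lerBlDl -lerBlDr.
apply/psd_shiftP => f; rewrite opprK; apply: inf_spectrum_le_form => //.
- exact: self_adjoint_sub.
- by apply: form_bounded_sub; exact: bounded_form.
Qed.

End quadratic_form_distance.

(** * Choice of the threshold *)

Lemma near_right0 (R : realType) (P : R -> Prop) :
  (\forall x \near 0^'+, P x) ->
  exists2 e : R, 0 < e & forall x, 0 < x <= e -> P x.
Proof.
move=> /nbhs_ballP[e /= e_gt0 eP]; exists (e / 2); first by rewrite divr_gt0.
move=> x /andP[x_gt0 xe]; apply: eP => //.
rewrite /ball/= sub0r normrN gtr0_norm//.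
by rewrite (le_lt_trans xe)// ltr_pdivrMr// mulr2n mulrDr mulr1 ltrDl.
Qed.

Lemma near_right00 (R : realType) (P : R * R -> Prop) :
  (\forall p \near ((0 : R)^'+, (0 : R)^'+), P p) ->
  exists2 e : R, 0 < e & forall x y, 0 < x <= e -> 0 < y <= e -> P (x, y).
Proof.
move=> [[Q Q'] /= [/near_right0[a a_gt0 Qa] /near_right0[b b_gt0 Qb]] QP].
exists (Num.min a b); first by rewrite lt_min a_gt0.
move=> x y /andP[x_gt0]; rewrite le_min => /andP[xa _].
move=> /andP[y_gt0]; rewrite le_min => /andP[_ yb].
by apply: QP; split; [apply: Qa; rewrite x_gt0|apply: Qb; rewrite y_gt0].
Qed.

(** * The regularized reconstruction *)

Theorem theorem3p1 (R : realType) (d : nat) (d_ge2 : (2 <= d)%N)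
  (Omega : set 'rV[R]_d)
  (domOmega : smooth_domain Omega)
  (connC : connected (~` closure Omega))
  (gamma0 kappap kappam : 'rV[R]_d -> R) (Dp Dm : set 'rV[R]_d)
  (inclD : indefinite_inclusion Omega gamma0 kappap kappam Dp Dm)
  (gamma : 'rV[R]_d -> R)
  (gammaE : gamma = perturbed gamma0 kappap kappam Dp Dm)
  (gammaL : Linfty_plus Omega gamma)
  (betaL beta : R) (betaL_gt0 : 0 < betaL) (beta_gt0 : 0 < beta)
  (betaL_le : (betaL%:E <= essinf Omega gamma0)%E)
  (kappap_le : (esssup Omega kappap <= beta%:E)%E)
  (kappam_le : (esssup Omega kappam <= (beta / (1 + beta) * betaL)%:E)%E)
  (N : R -> {linear Ldia Omega -> Ldia Omega})
  (N_bounded : forall delta : R, 0 < delta -> bounded_op (N delta))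
  (N_selfadj : forall delta : R, 0 < delta -> self_adjoint (N delta))
  (N_le : forall delta : R, 0 < delta -> (opnorm (N delta) <= delta%:E)%E)
  (Lamh : R -> ('rV[R]_d -> R) -> {linear Ldia Omega -> Ldia Omega})
  (Lamh_ae : forall (h : R) g g', 0 < h -> Linfty_plus Omega g ->
    Linfty_plus Omega g' -> {ae volume Omega, forall x, g x = g' x} ->
    forall f, Lamh h g f = Lamh h g' f)
  (Lamh_bounded : forall (h : R) g, 0 < h -> Linfty_plus Omega g ->
    bounded_op (Lamh h g))
  (Lamh_compact : forall (h : R) g, 0 < h -> Linfty_plus Omega g ->
    compact_op (Lamh h g))
  (Lamh_selfadj : forall (h : R) g, 0 < h -> Linfty_plus Omega g ->
    self_adjoint (Lamh h g))
  (omega : R -> R)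
  (Lamh_approx : forall (h : R) g, 0 < h -> Linfty_plus Omega g ->
    (opnorm (sub_op (NtD g) (Lamh h g))
     <= (omega h)%:E * Linfty_norm Omega g)%E)
  (omega_lim : omega h @[h --> 0^'+] --> (0 : R))
  (alphap alpham : R -> R -> set 'rV[R]_d -> R)
  (alphapL alphapU alphamL alphamU : R -> R -> R)
  (alphap_bound : forall (h delta : R) C, 0 < h -> 0 < delta -> admissible Omega C ->
    alphapL h delta <= alphap h delta C <= alphapU h delta)
  (alpham_bound : forall (h delta : R) C, 0 < h -> 0 < delta -> admissible Omega C ->
    alphamL h delta <= alpham h delta C <= alphamU h delta)
  (alphapU_lim : alphapU p.1 p.2 @[p --> ((0 : R)^'+, (0 : R)^'+)] --> (0 : R))
  (alphamU_lim : alphamU p.1 p.2 @[p --> ((0 : R)^'+, (0 : R)^'+)] --> (0 : R)) :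
  let Tp := Tplus (@NtD R d Omega) (NtD gamma) gamma0 beta in
  let Tm := Tminus (@NtD R d Omega) (NtD gamma) gamma0 beta betaL in
  let Tph h := Tplus (fun g => Lamh h g) (Lamh h gamma) gamma0 beta in
  let Tmh h := Tminus (fun g => Lamh h g) (Lamh h gamma) gamma0 beta betaL in
  let meas h delta := add_op (Lamh h gamma) (N delta) in
  let Tphd h delta := Tplus (fun g => Lamh h g) (meas h delta) gamma0 beta in
  let Tmhd h delta := Tminus (fun g => Lamh h g) (meas h delta) gamma0 beta betaL in
  let M := MM (cst 0) (cst 0) Tp Tm in
  let Mp := MM1 (cst 0) Tp in
  let Mm := MM1 (cst 0) Tm in
  ((forall h delta : R, 0 < h -> 0 < delta ->
      ((delta - alphapL h delta)%:E <=
        ereal_inf [set inf_spectrum (Tph h C) | C in M])%E /\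
      ((delta - alphamL h delta)%:E <=
        ereal_inf [set inf_spectrum (Tmh h C) | C in M])%E) ->
    forall lambda : R, 0 < lambda -> exists eps : R, 0 < eps /\
      forall h delta : R, 0 < h <= eps -> 0 < delta <= eps ->
        M `<=` MM (alphap h delta) (alpham h delta) (Tphd h delta) (Tmhd h delta)
        /\ MM (alphap h delta) (alpham h delta) (Tphd h delta) (Tmhd h delta)
           `<=` MM (cst lambda) (cst lambda) Tp Tm)
  /\
  ((forall h delta : R, 0 < h -> 0 < delta ->
      ((delta - alphapL h delta)%:E <=
        ereal_inf [set inf_spectrum (Tph h C) | C in Mp])%E /\
      ((delta - alphamL h delta)%:E <=
        ereal_inf [set inf_spectrum (Tmh h C) | C in Mm])%E) ->
    forall lambda : R, 0 < lambda -> exists eps : R, 0 < eps /\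
      forall h delta : R, 0 < h <= eps -> 0 < delta <= eps ->
        [/\ Mp `<=` MM1 (alphap h delta) (Tphd h delta),
            MM1 (alphap h delta) (Tphd h delta) `<=` MM1 (cst lambda) Tp,
            Mm `<=` MM1 (alpham h delta) (Tmhd h delta) &
            MM1 (alpham h delta) (Tmhd h delta) `<=` MM1 (cst lambda) Tm]).
Proof.
move=> Tp Tm Tph Tmh meas Tphd Tmhd M Mp Mm.
have [[gamma0L _ _ _] _] := inclD.
have [K Kbump] := Linfty_plus_add_indic _ _ _ _ _ gamma0L betaL_gt0 betaL_le.
pose cm := beta / (1 + beta) * betaL.
have beta1_gt0 : 0 < 1 + beta by rewrite addr_gt0.
have testp C : closed C -> Linfty_plus Omega (test_plus gamma0 beta C) /\
    (Linfty_norm Omega (test_plus gamma0 beta C) <= (K + `|beta|)%:E)%E.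
  by move=> cC; apply: Kbump => //; rewrite addr_gt0.
have testm C : closed C -> Linfty_plus Omega (test_minus gamma0 beta betaL C) /\
    (Linfty_norm Omega (test_minus gamma0 beta betaL C) <= (K + `|cm|)%:E)%E.
  move=> cC; have -> : test_minus gamma0 beta betaL C =
      (fun x => gamma0 x + - cm * \1_C x).
    by apply/funext => x; rewrite /test_minus mulNr.
  rewrite -[`|cm|]normrN; apply: Kbump => //.
  (* beta / (1 + beta) < 1 keeps the lowered conductivity positive. *)
  have -> : betaL + - cm = betaL / (1 + beta).
    by rewrite /cm; field; rewrite gt_eqF.
  by rewrite divr_gt0.
(* A common bound for the sup norms of gamma and of all test conductivities. *)
pose L := fine (Linfty_norm Omega gamma) + `|K| + `|beta| + `|cm|.
have gamma_norm : Linfty_norm Omega gamma = (fine (Linfty_norm Omega gamma))%:E.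
  by rewrite fineK// ge0_fin_numE ?Lnorm_ge0//; case: gammaL.
have gamma_norm_ge0 : 0 <= fine (Linfty_norm Omega gamma).
  by rewrite fine_ge0// Lnorm_ge0.
have L_ge0 : 0 <= L by rewrite !addr_ge0.
have approx h g : 0 < h -> Linfty_plus Omega g ->
    (Linfty_norm Omega g <= L%:E)%E ->
    form_close (Lamh h g) (NtD g) (`|omega h| * L).
  move=> h_gt0 gL g_le; apply: form_close_sym; apply: form_close_opnorm.
  apply: (le_trans (Lamh_approx _ _ h_gt0 gL)).
  have norm_ge0 : (0 <= Linfty_norm Omega g)%E by exact: Lnorm_ge0.
  rewrite EFinM; apply: (@le_trans _ _ (`|omega h|%:E * Linfty_norm Omega g)%E).
    by apply: lee_wpmul2r => //; rewrite lee_fin ler_norm.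
  by apply: lee_wpmul2l; rewrite // lee_fin.
have approx_gamma h : 0 < h ->
    form_close (Lamh h gamma) (NtD gamma) (`|omega h| * L).
  move=> h_gt0; apply: approx => //.
  rewrite gamma_norm lee_fin /L -!addrA lerDl.
  by rewrite !addr_ge0.
have approx_plus h C : 0 < h -> closed C ->
    form_close (Lamh h (test_plus gamma0 beta C))
      (NtD (test_plus gamma0 beta C))
      (`|omega h| * L).
  move=> h_gt0 /testp[tL t_le]; apply: approx => //; apply: (le_trans t_le).
  rewrite lee_fin /L; have := ler_norm K; have := normr_ge0 cm; lra.
have approx_minus h C : 0 < h -> closed C ->
    form_close (Lamh h (test_minus gamma0 beta betaL C))
      (NtD (test_minus gamma0 beta betaL C)) (`|omega h| * L).
  move=> h_gt0 /testm[tL t_le]; apply: approx => //; apply: (le_trans t_le).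
  rewrite lee_fin /L; have := ler_norm K; have := normr_ge0 beta; lra.
have meas_noise h delta : 0 < delta ->
    form_close (meas h delta) (Lamh h gamma) delta.
  by move=> delta_gt0; apply: form_close_add_op; exact: N_le.
have lower_plus h delta C : 0 < h -> 0 < delta -> admissible Omega C ->
    ((delta - alphapL h delta)%:E <= inf_spectrum (Tph h C))%E ->
    psd (Defs.shift (Tphd h delta C) (alphap h delta C)).
  move=> h_gt0 delta_gt0 aC; have [_ cC _] := aC; have [tL _] := testp _ cC.
  apply: psd_shift_inf_spectrum; [exact: Lamh_selfadj|exact: Lamh_bounded|
    exact: Lamh_selfadj|exact: Lamh_bounded| |].
    apply: form_close_sub (form_close_refl _).
    by apply: form_close_sym; exact: meas_noise.
  rewrite addr0; have /andP[+ _] := alphap_bound _ _ _ h_gt0 delta_gt0 aC; lra.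
have lower_minus h delta C : 0 < h -> 0 < delta -> admissible Omega C ->
    ((delta - alphamL h delta)%:E <= inf_spectrum (Tmh h C))%E ->
    psd (Defs.shift (Tmhd h delta C) (alpham h delta C)).
  move=> h_gt0 delta_gt0 aC; have [_ cC _] := aC; have [tL _] := testm _ cC.
  apply: psd_shift_inf_spectrum; [exact: Lamh_selfadj|exact: Lamh_bounded|
    exact: Lamh_selfadj|exact: Lamh_bounded| |].
    apply: form_close_sub (form_close_refl _) _.
    by apply: form_close_sym; exact: meas_noise.
  rewrite add0r; have /andP[+ _] := alpham_bound _ _ _ h_gt0 delta_gt0 aC; lra.
have upper lambda : 0 < lambda -> exists eps : R, 0 < eps /\
    forall h delta : R, 0 < h <= eps -> 0 < delta <= eps ->
    forall C, admissible Omega C ->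
      (psd (Defs.shift (Tphd h delta C) (alphap h delta C)) ->
       psd (Defs.shift (Tp C) lambda)) /\
      (psd (Defs.shift (Tmhd h delta C) (alpham h delta C)) ->
       psd (Defs.shift (Tm C) lambda)).
  move=> lambda_gt0.
  have lambda3_gt0 : 0 < lambda / 3 by rewrite divr_gt0.
  have tol_gt0 : 0 < lambda / 6 / (L + 1) by rewrite !divr_gt0// ltr_wpDl.
  move/cvgr0Pnorm_lt : alphapU_lim.
  move=> /(_ _ lambda3_gt0)/near_right00[ep ep_gt0 Hp].
  move/cvgr0Pnorm_lt : alphamU_lim.
  move=> /(_ _ lambda3_gt0)/near_right00[em em_gt0 Hm].
  move/cvgr0Pnorm_lt : omega_lim => /(_ _ tol_gt0)/near_right0[eo eo_gt0 Ho].
  (* lambda splits as lambda / 3 for alpha^U, lambda / 3 for delta, and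
     lambda / 6 for each of the two discretization errors in T. *)
  exists (Num.min (Num.min ep em) (Num.min eo (lambda / 3))).
  split; first by rewrite !lt_min ep_gt0 em_gt0 eo_gt0.
  move=> h delta /andP[h_gt0]; rewrite !le_min.
  move=> /andP[/andP[hp hm] /andP[ho _]] /andP[delta_gt0].
  move=> /andP[/andP[dp dm] /andP[_ d_le]] C aC; have [_ cC _] := aC.
  have omega_le : `|omega h| * L <= lambda / 6.
    have /(_ _)/ltW := Ho h; rewrite h_gt0 ho => /(_ isT).
    by rewrite ler_pdivlMr ?ltr_wpDl//; apply: le_trans; rewrite ler_wpM2l//
      lerDl.
  have meas_close := form_close_trans
    (meas_noise h delta delta_gt0) (approx_gamma h h_gt0).
  split.
    apply: psd_shift_close.
      exact: form_close_sub meas_close (approx_plus h C h_gt0 cC).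
    have /andP[_] := alphap_bound _ _ _ h_gt0 delta_gt0 aC.
    have := ler_norm (alphapU h delta).
    have := Hp h delta; rewrite h_gt0 delta_gt0 hp dp => /(_ isT isT) /=; lra.
  apply: psd_shift_close.
    exact: form_close_sub (approx_minus h C h_gt0 cC) meas_close.
  have /andP[_] := alpham_bound _ _ _ h_gt0 delta_gt0 aC.
  have := ler_norm (alphamU h delta).
  have := Hm h delta; rewrite h_gt0 delta_gt0 hm dm => /(_ isT isT) /=; lra.
have inf_le (X : set (set 'rV[R]_d))
    (S : set 'rV[R]_d -> Ldia Omega -> Ldia Omega)
    (m : R) C :
    (m%:E <= ereal_inf [set inf_spectrum (S C) | C in X])%E -> X C ->
    (m%:E <= inf_spectrum (S C))%E.
  by move=> mX XC; apply: (le_trans mX); apply: ereal_inf_lbound; exists C.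
split=> spec lambda /upper[eps [eps_gt0 up]]; exists eps; split=> //;
  move=> h delta hE deltaE; have up' := up h delta hE deltaE;
  have /andP[h_gt0 _] := hE; have /andP[delta_gt0 _] := deltaE;
  have [specp specm] := spec h delta h_gt0 delta_gt0.
  split=> C.
    move=> MC; have [aC _ _] := MC; split; first exact: aC.
      exact: lower_plus (inf_le _ _ _ _ specp MC).
    exact: lower_minus (inf_le _ _ _ _ specm MC).
  move=> [aC Cp Cm]; have [upp upm] := up' C aC.
  split; [exact: aC|exact: (upp Cp)|exact: (upm Cm)].
split=> C.
- move=> MC; have [aC _ _] := MC.
  have Cp := lower_plus _ _ _ h_gt0 delta_gt0 aC (inf_le _ _ _ _ specp MC).
  split; [exact: aC|exact: Cp|exact: Cp].
- move=> [aC Cp _]; have /(_ Cp) {}Cp := (up' C aC).1.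
  split; [exact: aC|exact: Cp|exact: Cp].
- move=> MC; have [aC _ _] := MC.
  have Cm := lower_minus _ _ _ h_gt0 delta_gt0 aC (inf_le _ _ _ _ specm MC).
  split; [exact: aC|exact: Cm|exact: Cm].
- move=> [aC Cm _]; have /(_ Cm) {}Cm := (up' C aC).2.
  split; [exact: aC|exact: Cm|exact: Cm].
Qed.
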